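(* Let $G$ be a graph with $n$ vertices and let $(M,x)\in\mathcal{P}(G)$. Then: (1) For every independent set $S$ of $G$, $|S|\le F_S(M,x)$, with equality if and only if the principal submatrix $M[S]$ is diagonal and there is a constant $c$ such that $\frac{(M)_{vv}}{x_v^2}=c$ for all $v\in S$ and $c\,x_v=\sum_{u\in S}(M)_{vu}x_u^{-1}$ for all $v\notin S$. (2) $\alpha(G)\le F(M,x)$, with equality if and only if $G$ has an independent set $C$ such that $M[C]$ is diagonal and, with $c=\max_{u\in V(G)}\frac{(M)_{uu}}{x_u^2}$, one has $\frac{(M)_{vv}}{x_v^2}=c$ for all $v\in C$ and $c\,x_v=\sum_{u\in C}(M)_{vu}x_u^{-1}$ for all $v\notin C$. Moreover, if an independent set $C$ satisfies these conditions, then $\alpha(G)=|C|=F(M,x)$. (3) Suppose the vertices are labelled $1,\dots,n$ so that $\frac{(M)_{11}}{x_1^2}\ge\cdots\ge\frac{(M)_{nn}}{x_n^2}$. If $\alpha(G)\ge t$ for some positive integer $t$, then $\alpha(G)\le F_T(M,x)$ where $T=\{1,\dots,t\}$.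
   Context: Graphs are finite and simple; $\alpha(G)$ is the independence number. For a real square matrix $M$, the group inverse $M^\#$ is the unique matrix $X$ with $MXM=M$, $XMX=X$, $MX=XM$ (it exists for positive semidefinite $M$: if $M=U\mathrm{diag}(\lambda_i)U^\top$ then $M^\#=U\mathrm{diag}(\lambda_i^+)U^\top$ with $\lambda^+=\lambda^{-1}$ for $\lambda>0$ and $0^+=0$). $R(M)$ denotes the range (column space) of $M$. For $S\subseteq V(G)$, $M[S]$ is the principal submatrix with rows and columns indexed by $S$. A vector is total nonzero if all its entries are nonzero. $\mathcal{P}(G)$ is the set of pairs $(M,x)$ where $M$ is a real positive semidefinite $n\times n$ matrix indexed by $V(G)$ and $x=(x_1,\dots,x_n)^\top\in R(M)$ is a total nonzero real vector with $(M)_{ij}x_ix_j\le0$ whenever $i,j$ are distinct nonadjacent vertices. For $(M,x)\in\mathcal{P}(G)$ and nonempty $T\subseteq V(G)$: $F(M,x)=x^\top M^\#x\max_{u\in V(G)}\frac{(M)_{uu}}{x_u^2}$ and $F_T(M,x)=\frac{x^\top M^\#x}{|T|}\sum_{u\in T}\frac{(M)_{uu}}{x_u^2}$. *)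

(* Defs.v *)
From HB Require Import structures.
From mathcomp Require Import all_boot all_order all_algebra.
From mathcomp Require Import boolp classical_sets reals.

Set Implicit Arguments.
Unset Strict Implicit.
Unset Printing Implicit Defensive.

Import Order.TTheory GRing.Theory Num.Theory.
Local Open Scope ring_scope.

Record sgraph (n : nat) := SGraph {
  adj :> rel 'I_n;
  adj_sym : symmetric adj;
  adj_irr : irreflexive adj
}.

Definition independent n (G : sgraph n) (S : {set 'I_n}) : bool :=
  [forall u in S, forall v in S, ~~ G u v].

Definition alpha n (G : sgraph n) : nat :=
  \max_(S : {set 'I_n} | independent G S) #|S|.

Section Matrices.
Variables (R : realType) (n : nat).
Implicit Types (M X : 'M[R]_n) (x : 'cV[R]_n) (S T : {set 'I_n}).

Definition psd M : Prop :=
  M^T = M /\ forall y : 'cV[R]_n, 0 <= (y^T *m M *m y) ord0 ord0.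

Definition is_group_inverse M X : Prop :=
  [/\ M *m X *m M = M, X *m M *m X = X & M *m X = X *m M].

(* There is at most one group inverse; the value is 0 when there is none,
   which never happens for a positive semidefinite M. *)
Definition group_inverse M : 'M[R]_n :=
  xget 0 [set X | is_group_inverse M X]%classic.

Definition in_range M x : Prop := exists y : 'cV[R]_n, x = M *m y.

Definition total_nonzero x : Prop := forall u, x u ord0 != 0.

(* Rows and columns are listed in the increasing order of the elements of S. *)
Definition principal_submx M S : 'M[R]_#|S| :=
  mxsub (fun i : 'I_#|S| => enum_val i) (fun i : 'I_#|S| => enum_val i) M.

Definition in_P (G : sgraph n) M x : Prop :=
  [/\ psd M, in_range M x, total_nonzero x &
      forall i j, i != j -> ~~ G i j -> M i j * x i ord0 * x j ord0 <= 0].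

Definition diag_ratio M x (u : 'I_n) : R := M u u / x u ord0 ^+ 2.

(* The diagonal of a positive semidefinite matrix is nonnegative, so the base
   value 0 only matters when n = 0. *)
Definition max_diag_ratio M x : R := \big[Num.max/0]_u diag_ratio M x u.

Definition ginv_form M x : R :=
  (x^T *m group_inverse M *m x) ord0 ord0.

Definition F M x : R := ginv_form M x * max_diag_ratio M x.

(* The mathematical notion requires T nonempty; here F_on M x set0 = 0. *)
Definition F_on T M x : R :=
  ginv_form M x / #|T|%:R * \sum_(u in T) diag_ratio M x u.

Definition equality_condition M x S (c : R) : Prop :=
  [/\ is_diag_mx (principal_submx M S),
      forall v, v \in S -> diag_ratio M x v = c &
      forall v, v \notin S ->
        c * x v ord0 = \sum_(u in S) M v u * (x u ord0)^-1].

End Matrices.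

(* Main.v *)
(* Write x = M y and let z be the vector with entries 1/x_u on S and 0 elsewhere.
   Then q := x^T M^# x = y^T M y and |S| = z^T x = z^T M y, so Cauchy-Schwarz for
   the form M gives |S|^2 <= q (z^T M z).  The off-diagonal terms of z^T M z are
   nonpositive because S is independent, so z^T M z is at most the sum of the
   diagonal ratios over S.  Equality holds iff these terms vanish, i.e. M[S] is
   diagonal, and M z is a multiple of x.  Bounds (2) and (3) follow by comparing
   the average ratio over a maximum independent set with the largest ratio, and
   with the average of the t largest ratios. *)
Require Import Defs.
From mathcomp Require Import all_boot all_order all_algebra all_fingroup.
From mathcomp Require Import reals.
From mathcomp Require classical_sets.
From mathcomp Require Import ring lra.
Import Order.TTheory GRing.Theory Num.Theory.
Local Open Scope ring_scope.

(** * Existence of the group inverse of a symmetric matrix *)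

Lemma tr_mul_self_eq0 (R : realDomainType) (n : nat) (v : 'cV[R]_n) :
  (v^T *m v) ord0 ord0 = 0 -> v = 0.
Proof.
rewrite mxE => /eqP; rewrite psumr_eq0 => [/allP v0|i _]; last first.
  by rewrite mxE -expr2 sqr_ge0.
apply/colP => i; have := v0 i (mem_index_enum i).
by rewrite !mxE mulf_eq0 orbb => /eqP.
Qed.

(* As [ker (M *m M) = ker M], the matrices [M] and [M *m M] have the same row
   space, so [M = A *m M *m M]; the group inverse is then [A *m A *m M]. *)
Lemma sym_group_inverse_exists (R : realType) (n : nat) (M : 'M[R]_n) :
  M^T = M -> exists X, is_group_inverse M X.
Proof.
move=> symM.
have capM0 : (M :&: kermx M)%MS = 0.
  apply/eqP; rewrite -submx0; apply/rV_subP => v; rewrite sub_capmx.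
  case/andP=> /submxP[w ->] /sub_kermxP wMM0.
  suff -> : w *m M = 0 by rewrite sub0mx.
  apply: trmx_inj; rewrite trmx0; apply: tr_mul_self_eq0.
  by rewrite trmxK trmx_mul symM mulmxA wMM0 mul0mx mxE.
have rankMM : \rank (M *m M) = \rank M.
  by rewrite -[RHS](mxrank_mul_ker M M) capM0 mxrank0 addn0.
have /submxP[A MA] : (M <= M *m M)%MS.
  by have [_] := mxrank_leqif_sup (submxMl M M); rewrite rankMM eqxx => <-.
have MB : M = M *m M *m A^T by rewrite -[LHS]symM {1}MA !trmx_mul symM.
(* Both sides equal [A *m M *m M *m A^T]. *)
have AM : A *m M = M *m A^T by rewrite {1}MB !mulmxA -(mulmxA A) -MA.
have MAM : M *m A *m M = M by rewrite -mulmxA AM mulmxA -MB.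
have XM : A *m A *m M *m M = A *m M by rewrite -!mulmxA -MA.
have MX : M *m (A *m A *m M) = A *m M.
  by rewrite -(mulmxA A A) AM !mulmxA MAM.
exists (A *m A *m M); split; last by rewrite MX XM.
  by rewrite MX -mulmxA -MA.
by rewrite XM -(mulmxA A M) MX mulmxA.
Qed.

(** * Quadratic forms of symmetric and positive semidefinite matrices *)

Section Psd.
Variables (R : realType) (n : nat).
Implicit Types (M : 'M[R]_n) (x y w z : 'cV[R]_n).

(** [M X M = M] removes the group inverse [X] from the form, so that later arguments only handle
    [y^T M y]. *)
Lemma ginv_form_mulmx M y :
  M^T = M -> ginv_form M (M *m y) = (y^T *m M *m y) ord0 ord0.
Proof.
move=> symM; rewrite /ginv_form /group_inverse.
case: classical_sets.xgetP => [X _ [MXM _ _]|none].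
  by rewrite trmx_mul symM -!mulmxA (mulmxA X) (mulmxA M) (mulmxA M X) MXM.
by have [X /none] := sym_group_inverse_exists _ _ _ symM.
Qed.

Lemma form_sym M y z :
  M^T = M -> (y^T *m M *m z) ord0 ord0 = (z^T *m M *m y) ord0 ord0.
Proof.
move=> symM; transitivity ((y^T *m M *m z)^T ord0 ord0); first by rewrite [RHS]mxE.
by rewrite !trmx_mul trmxK symM mulmxA.
Qed.

Lemma form_lin M (a b : R) y z : M^T = M ->
  ((a *: y - b *: z)^T *m M *m (a *: y - b *: z)) ord0 ord0 =
  a ^+ 2 * (y^T *m M *m y) ord0 ord0
  - 2 * a * b * (z^T *m M *m y) ord0 ord0
  + b ^+ 2 * (z^T *m M *m z) ord0 ord0.
Proof.
move=> symM; have := form_sym M y z symM.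
have -> : (a *: y - b *: z)^T = a *: y^T - b *: z^T.
  by apply/rowP => i; rewrite !mxE.
rewrite !mulmxBl !mulmxBr -!scalemxAr -!scalemxAl.
rewrite !mxE => ->; ring.
Qed.

Lemma psd_form_eq0 M w :
  psd M -> (w^T *m M *m w) ord0 ord0 = 0 -> M *m w = 0.
Proof.
case=> symM posM w0; apply: tr_mul_self_eq0.
set p := (_ *m _) _ _; set r := ((M *m w)^T *m M *m (M *m w)) ord0 ord0.
have r0 : 0 <= r by exact: posM.
(* Here [p] is the squared norm of [M w]. The form of this combination is [- (r + 2) p^2], so its
   nonnegativity forces [p = 0]. *)
have := posM ((r + 1) *: w - p *: (M *m w)); rewrite form_lin // w0 -/r.
have -> : ((M *m w)^T *m M *m w) ord0 ord0 = p by rewrite -mulmxA.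
move=> h; apply/eqP; rewrite -sqrf_eq0; apply/eqP/le_anti; rewrite sqr_ge0 andbT; nra.
Qed.

End Psd.

(** * The reciprocal vector on a vertex set and the equality condition *)

Section Bound.
Variables (R : realType) (n : nat) (G : sgraph n).
Implicit Types (M : 'M[R]_n) (x y : 'cV[R]_n) (S : {set 'I_n}).

(** The test vector [z] to which Cauchy-Schwarz is applied. *)
Definition inv_indicator x S : 'cV[R]_n :=
  \col_u (if u \in S then (x u ord0)^-1 else 0).

Lemma mulmx_inv_indicator M x S v :
  (M *m inv_indicator x S) v ord0 = \sum_(u in S) M v u * (x u ord0)^-1.
Proof.
rewrite mxE [RHS]big_mkcond /=; apply: eq_bigr => u _.
by rewrite mxE; case: ifP; rewrite ?mulr0.
Qed.

Lemma inv_indicator_mulmx x S : total_nonzero x ->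
  ((inv_indicator x S)^T *m x) ord0 ord0 = #|S|%:R.
Proof.
move=> x0; rewrite mxE -sumr_const [RHS]big_mkcond /=; apply: eq_bigr => u _.
by rewrite !mxE; case: ifP; rewrite ?mul0r // mulVf.
Qed.

Lemma inv_indicator_form M x S :
  ((inv_indicator x S)^T *m M *m inv_indicator x S) ord0 ord0 =
  \sum_(u in S) diag_ratio M x u +
  \sum_(u in S) \sum_(v in S | v != u) M u v / (x u ord0 * x v ord0).
Proof.
rewrite -mulmxA mxE -big_split [RHS]big_mkcond /=; apply: eq_bigr => u _.
rewrite mulmx_inv_indicator !mxE; case: ifP => uS; last by rewrite mul0r.
rewrite (bigD1 u) //= mulrDr /diag_ratio; congr (_ + _).
  by rewrite mulrCA -invfM expr2.
by rewrite mulr_sumr; apply: eq_bigr => v _; rewrite mulrCA -invfM.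
Qed.

Lemma is_diag_principal_submxP M S :
  reflect {in S &, forall u v, u != v -> M u v = 0}
          (is_diag_mx (principal_submx M S)).
Proof.
apply: (iffP is_diag_mxP) => [diagM u v uS vS uv|diagM i j ij].
  rewrite -(enum_rankK_in uS uS) -(enum_rankK_in uS vS).
  have := diagM (enum_rank_in uS u) (enum_rank_in uS v); rewrite mxE; apply.
  by apply: contraNneq uv => /ord_inj /(can_in_inj (enum_rankK_in uS))->.
rewrite mxE; apply: diagM; rewrite ?enum_valP //.
by rewrite (inj_eq enum_val_inj).
Qed.

(** Once [M[S]] is diagonal, row [v] in [S] of [M z = c x] says that the diagonal ratio at [v] is
    [c]; the rows outside [S] are the last clause of the condition. *)
Lemma equality_conditionE M x S c : total_nonzero x ->
  equality_condition M x S c <->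
  {in S &, forall u v, u != v -> M u v = 0} /\
  M *m inv_indicator x S = c *: x.
Proof.
move=> x0.
have diag_row v : {in S &, forall u v, u != v -> M u v = 0} -> v \in S ->
    (M *m inv_indicator x S) v ord0 = diag_ratio M x v * x v ord0.
  move=> diagM vS; rewrite mulmx_inv_indicator (bigD1 v) //= big1 ?addr0.
    by rewrite /diag_ratio; field; exact: x0.
  by move=> u /andP[uS uv]; rewrite diagM ?mul0r // eq_sym.
split=> [[/is_diag_principal_submxP diagM ratio outS]|[diagM Mz]].
  split=> //; apply/colP => v; rewrite [RHS]mxE.
  case: (boolP (v \in S)) => vS; first by rewrite diag_row // ratio.
  by rewrite mulmx_inv_indicator outS.
split; first exact/is_diag_principal_submxP.
  by move=> v vS; apply: (mulIf (x0 v)); rewrite -diag_row // Mz mxE.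
by move=> v _; rewrite -mulmx_inv_indicator Mz mxE.
Qed.

Lemma alpha_attained : exists2 S, independent G S & alpha G = #|S|.
Proof.
have ind0 : independent G finset.set0 by apply/forall_inP => u; rewrite inE.
rewrite /alpha (bigop.bigmax_eq_arg _ ind0).
by case: fintype.arg_maxnP => // S indS _; exists S.
Qed.

Lemma independent_card_le_alpha S : independent G S -> (#|S| <= alpha G)%N.
Proof. by move=> indS; exact: bigop.leq_bigmax_cond. Qed.

(** * The three bounds for a pair in P(G) *)

Section InP.
Variables (M : 'M[R]_n) (x : 'cV[R]_n).
Hypothesis hMx : in_P G M x.

Lemma ginv_form_ge0 : 0 <= ginv_form M x.
Proof. by case: hMx => -[symM posM] [y ->] _ _; rewrite ginv_form_mulmx. Qed.

(** If [y^T M y] vanished, then [x = M y] would be zero, although its entries are nonzero. *)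
Lemma ginv_form_gt0 : (0 < n)%N -> 0 < ginv_form M x.
Proof.
move=> n0; rewrite lt_neqAle ginv_form_ge0 andbT eq_sym.
case: hMx => -[symM posM] [y xE] x0 _; rewrite xE ginv_form_mulmx //.
apply/eqP => /(psd_form_eq0 _ _ _ _ (conj symM posM)) My0.
by have := x0 (Ordinal n0); rewrite xE My0 mxE eqxx.
Qed.

(** Pairing [M z = c x] with [y] gives [c q] on the right, and on the left [y^T M z = z^T x], which
    counts [S]. *)
Lemma card_equality_condition S c :
  equality_condition M x S c -> #|S|%:R = ginv_form M x * c.
Proof.
case: hMx => -[symM posM] [y xE] x0 _ /(equality_conditionE _ _ _ _ x0)[_ Mz].
have -> : ginv_form M x = (y^T *m x) ord0 ord0.
  by rewrite xE ginv_form_mulmx // mulmxA.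
rewrite -(inv_indicator_mulmx x S x0).
have -> : (inv_indicator x S)^T *m x = (inv_indicator x S)^T *m M *m y.
  by rewrite -mulmxA -xE.
by rewrite form_sym // -mulmxA Mz -scalemxAr mxE mulrC.
Qed.

Lemma off_diag_le0 S : independent G S -> {in S &, forall u v, v != u ->
  M u v / (x u ord0 * x v ord0) <= 0}.
Proof.
move=> indS u v uS vS uv; case: hMx => _ _ x0 /(_ u v).
rewrite eq_sym uv => /(_ isT).
have -> : ~~ G u v by move/forall_inP: indS => /(_ u uS)/forall_inP; apply.
move=> /(_ isT) Mle0.
(* Dividing by a positive square keeps the sign given by [in_P]. *)
have -> : M u v / (x u ord0 * x v ord0) =
    M u v * x u ord0 * x v ord0 / (x u ord0 * x v ord0) ^+ 2.
  by field; rewrite !x0.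
by rewrite pmulr_lle0 // invr_gt0 exprn_even_gt0 //= mulf_neq0.
Qed.

(* The form of [w] is [q] times the defect in the Cauchy-Schwarz inequality for
   [z^T M y]; it vanishes only if [M w = 0], that is [q M z = |S| x]. *)
Lemma indep_bound S : independent G S -> (0 < #|S|)%N ->
  #|S|%:R ^+ 2 <= ginv_form M x * \sum_(u in S) diag_ratio M x u /\
  (#|S|%:R ^+ 2 = ginv_form M x * \sum_(u in S) diag_ratio M x u ->
   equality_condition M x S (#|S|%:R / ginv_form M x)).
Proof.
move=> indS S0; have n0 : (0 < n)%N.
  by apply: leq_trans S0 _; rewrite -[n in (_ <= n)%N]card_ord max_card.
have q0 := ginv_form_gt0 n0; have off := off_diag_le0 _ indS.
have [[symM posM] [y xE] x0 _] := hMx.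
set q := ginv_form M x in q0 *; set z := inv_indicator x S.
set D := \sum_(u in S) _; set a : R := #|S|%:R.
set E := \sum_(u in S) \sum_(v in S | v != u) M u v / (x u ord0 * x v ord0).
have E_le0 : E <= 0.
  by apply: sumr_le0 => u uS; apply: sumr_le0 => v /andP[vS]; exact: off.
have qE : (y^T *m M *m y) ord0 ord0 = q by rewrite /q xE ginv_form_mulmx.
have zy : (z^T *m M *m y) ord0 ord0 = a.
  by rewrite -mulmxA -xE inv_indicator_mulmx.
have zz : (z^T *m M *m z) ord0 ord0 = D + E by exact: inv_indicator_form.
set w := q *: z - a *: y.
have wE : (w^T *m M *m w) ord0 ord0 = q * (q * (D + E) - a ^+ 2).
  by rewrite form_lin // zz qE form_sym // zy; ring.
have w_ge0 : 0 <= q * (D + E) - a ^+ 2.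
  by rewrite -(pmulr_rge0 _ q0) -wE; exact: posM.
have qE_le0 : q * E <= 0 by rewrite pmulr_rle0.
split=> [|aE]; first nra.
(* With [a ^+ 2 = q * D] the defect [w_ge0] reduces to [0 <= q * E]. *)
have {}E_eq0 : E = 0.
  apply/eqP; rewrite -(inj_eq (mulfI (lt0r_neq0 q0))) mulr0.
  by apply/eqP/le_anti; rewrite qE_le0 /=; nra.
apply/equality_conditionE => //; split.
  move=> u v uS vS uv; apply/eqP.
  (* A vanishing sum of nonpositive terms has only zero terms; signs are flipped to sum nonnegative
     ones. *)
  have /eqP := E_eq0; rewrite -oppr_eq0 /E -sumrN psumr_eq0; last first.
    by move=> i iS; rewrite oppr_ge0; apply: sumr_le0 => j /andP[jS]; exact: off.
  move=> /allP /(_ u (mem_index_enum u)); rewrite uS /= -sumrN psumr_eq0.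
    move=> /allP /(_ v (mem_index_enum v)); rewrite vS eq_sym uv /= oppr_eq0.
    by rewrite mulf_eq0 invr_eq0 mulf_eq0 !(negPf (x0 _)) !orbF.
  by move=> j /andP[jS ju]; rewrite oppr_ge0; exact: off.
have : M *m w = 0.
  apply: psd_form_eq0; first by split.
  by rewrite wE E_eq0 addr0 aE subrr mulr0.
rewrite mulmxBr -!scalemxAr -xE => /eqP; rewrite subr_eq0 => /eqP Mz.
by rewrite mulrC -scalerA -Mz scalerA mulVf ?scale1r ?lt0r_neq0.
Qed.

Lemma card_le_F_on S : independent G S ->
  #|S|%:R <= F_on S M x /\
  (#|S|%:R = F_on S M x <-> exists c : R, equality_condition M x S c).
Proof.
move=> indS; have [S0|Sgt0] := posnP #|S|.
  have -> : S = finset.set0 by apply/eqP; rewrite -cards_eq0 S0.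
  (* For the empty set [F_on] is 0, and [c = 0] works because the sums over [S] are empty. *)
  rewrite /F_on cards0 invr0 mulr0 mul0r; split=> //; split=> // _; exists 0.
  split=> [|v|v _]; rewrite ?inE ?big_set0 ?mul0r //.
  by apply/is_diag_principal_submxP => u v; rewrite inE.
have a0 : 0 < #|S|%:R :> R by rewrite ltr0n.
have FE : F_on S M x = ginv_form M x * (\sum_(u in S) diag_ratio M x u) / #|S|%:R.
  by rewrite /F_on mulrAC.
have [bound eqc] := indep_bound _ indS Sgt0.
rewrite FE; split; first by rewrite ler_pdivlMr // -expr2.
split=> [aE|[c cond]].
  exists (#|S|%:R / ginv_form M x); apply: eqc.
  by rewrite expr2 {1}aE divfK ?lt0r_neq0.
have [_ ratio _] := cond.
rewrite (eq_bigr (fun=> c)) // sumr_const -[c *+ _]mulr_natr mulrA mulfK ?lt0r_neq0 //.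
exact: card_equality_condition.
Qed.

Lemma le_max_diag_ratio u : diag_ratio M x u <= max_diag_ratio M x.
Proof. exact: le_bigmax. Qed.

Lemma F_on_le_F S : F_on S M x <= F M x.
Proof.
have q0 := ginv_form_ge0; rewrite /F_on /F -mulrA ler_wpM2l //.
have [S0|Sgt0] := posnP #|S|.
  rewrite S0 invr0 mul0r /max_diag_ratio; apply: bigmax_ge_id.
rewrite mulrC ler_pdivrMr ?ltr0n // mulr_natr -sumr_const.
by apply: ler_sum => u _; exact: le_max_diag_ratio.
Qed.

Lemma alpha_le_F : (alpha G)%:R <= F M x.
Proof.
have [S indS ->] := alpha_attained.
by apply: le_trans (F_on_le_F S); have [] := card_le_F_on _ indS.
Qed.

Lemma alpha_equality_condition C : independent G C ->
  equality_condition M x C (max_diag_ratio M x) ->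
  alpha G = #|C| /\ #|C|%:R = F M x.
Proof.
move=> indC /card_equality_condition CF; split=> //.
apply/eqP; rewrite eqn_leq independent_card_le_alpha // andbT.
by rewrite -(ler_nat R) CF alpha_le_F.
Qed.

Lemma alpha_eq_F : (alpha G)%:R = F M x <->
  exists C : {set 'I_n}, independent G C /\
    equality_condition M x C (max_diag_ratio M x).
Proof.
split=> [aF|[C [indC /(alpha_equality_condition _ indC)[-> ->]]]] //.
have [C indC aC] := alpha_attained; exists C; split=> //.
have [le_on [eq_on _]] := card_le_F_on _ indC.
(* The chain [#|C| <= F_on C M x <= F M x = #|C|] collapses, giving the equality case for [C]. *)
have [c cond] : exists c : R, equality_condition M x C c.
  by apply: eq_on; apply/le_anti; rewrite le_on -aC aF F_on_le_F.
(* Without vertices [q] cannot be cancelled, but the clauses on vertices are then vacuous. *)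
have [n0|n0] := posnP n.
  have no_vertex (v : 'I_n) : False by case: v => v; rewrite n0.
  by case: cond => diagC _ _; split=> // v; case: (no_vertex v).
suff <- : c = max_diag_ratio M x by [].
(* Both [q * c] and [q * max_diag_ratio M x] equal [#|C|]. *)
apply: (mulfI (lt0r_neq0 (ginv_form_gt0 n0))).
by rewrite -(card_equality_condition _ _ cond) -aC.
Qed.

Lemma alpha_le_F_on_top (sigma : {perm 'I_n}) (t : nat) :
  (forall i j : 'I_n, (i <= j)%N ->
     diag_ratio M x (sigma j) <= diag_ratio M x (sigma i)) ->
  (0 < t)%N -> (t <= alpha G)%N ->
  (alpha G)%:R <= F_on [set sigma i | i : 'I_n & (i < t)%N] M x.
Proof.
move=> sorted t0; have [S indS ->] := alpha_attained => tS.
have tn : (t <= n)%N by rewrite (leq_trans tS) // -[n in (_ <= n)%N]card_ord max_card.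
have [le_on _] := card_le_F_on _ indS; apply: le_trans le_on _.
set T := finset.imset _ _.
have cardT : #|T| = t.
  rewrite card_imset; last exact: perm_inj.
  rewrite -sum1_card (eq_bigl (fun i : 'I_n => (i < t)%N)); last by move=> i; rewrite inE.
  by rewrite -(big_ord_widen_cond n xpredT (fun=> 1%N)) // sum1_card card_ord.
rewrite /F_on cardT -!mulrA ler_wpM2l ?ginv_form_ge0 //.
have last_lt : (t.-1 < n)%N by rewrite prednK.
(* The least ratio on [T], at label [t.-1] since labels start from 0; it separates [T] from its
   complement. *)
set m := diag_ratio M x (sigma (Ordinal last_lt)).
have T_ge u : u \in T -> m <= diag_ratio M x u.
  case/imsetP => i; rewrite inE => it ->; apply: sorted => /=.
  by rewrite -ltnS prednK.
have T_le u : u \notin T -> diag_ratio M x u <= m.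
  move=> uT; rewrite -[u](permKV sigma); apply: sorted => /=.
  rewrite leqNgt; apply: contra uT => lt_u.
  apply/imsetP; exists ((sigma^-1)%g u); last by rewrite permKV.
  by rewrite inE (ltn_trans lt_u) // ltn_predL.
set r := diag_ratio M x in m T_ge T_le *.
(* The average of [r] over a nonempty [A] is [m] plus the total excess over [m] divided by [#|A|],
   so only excesses need comparing. *)
have excess (A : {set 'I_n}) : \sum_(u in A) r u = \sum_(u in A) (r u - m) + m * #|A|%:R.
  by rewrite sumrB sumr_const mulr_natr subrK.
(* Passing from [S] to [T] drops terms that are at most 0 and adds terms that are at least 0. *)
have le_excess : \sum_(u in S) (r u - m) <= \sum_(u in T) (r u - m).
  rewrite big_mkcond [leRHS]big_mkcond /=; apply: ler_sum => u _.
  case: ifP => _; case: ifPn => uT //.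
    by rewrite subr_le0 T_le.
  by rewrite subr_ge0 T_ge.
have excess_ge0 : 0 <= \sum_(u in T) (r u - m).
  by apply: sumr_ge0 => u uT; rewrite subr_ge0 T_ge.
have s0 : 0 < #|S|%:R :> R by rewrite ltr0n (leq_trans t0).
have t0' : 0 < t%:R :> R by rewrite ltr0n.
rewrite !excess cardT ![_^-1 * _]mulrC !mulrDl !mulfK ?lt0r_neq0 // lerD2r.
(* First the numerator changes, then the denominator, where [t <= #|S|] and the excess over [T] is
   nonnegative. *)
apply: (le_trans (y := (\sum_(u in T) (r u - m)) / #|S|%:R)).
  by rewrite ler_pM2r ?invr_gt0.
by rewrite ler_wpM2l // lef_pV2 ?ler_nat.
Qed.

End InP.
End Bound.

Theorem theorem3p1 (R : realType) (n : nat) (G : sgraph n)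
    (M : 'M[R]_n) (x : 'cV[R]_n) (hMx : in_P G M x) :
  [/\ (forall S : {set 'I_n}, independent G S ->
         (#|S|%:R <= F_on S M x) /\
         (#|S|%:R = F_on S M x <-> exists c : R, equality_condition M x S c)),
      [/\ (alpha G)%:R <= F M x,
          (alpha G)%:R = F M x <->
            (exists C : {set 'I_n}, independent G C /\
               equality_condition M x C (max_diag_ratio M x)) &
          (forall C : {set 'I_n}, independent G C ->
             equality_condition M x C (max_diag_ratio M x) ->
             alpha G = #|C| /\ #|C|%:R = F M x)] &
      (* sigma i is the vertex with label i, labels being counted from 0 *)
      (forall (sigma : {perm 'I_n}) (t : nat),
         (forall i j : 'I_n, (i <= j)%N ->
            diag_ratio M x (sigma j) <= diag_ratio M x (sigma i)) ->
         (0 < t)%N -> (t <= alpha G)%N ->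
         (alpha G)%:R <= F_on [set sigma i | i : 'I_n & (i < t)%N] M x)].
Proof.
split; first by move=> S; exact: card_le_F_on.
  by split; [exact: alpha_le_F | exact: alpha_eq_F | exact: alpha_equality_condition].
by move=> sigma t; exact: alpha_le_F_on_top.
Qed.
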